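(* Let $\mathcal{A}$ be an alphabet, let $n\ge 1$ and $p\ge 2$ be integers, and let $w$ be a universal partial word for $\mathcal{A}^n$. Let $\mu(w,p)$ be the $p\times |w|$ partial matrix whose first row is $w$ and all of whose remaining $p-1$ rows consist only of the symbol $\diamond$. Then $\mu(w,p)$ is a universal partial matrix for $\mathcal{A}^{p\times n}$.
   Context: An alphabet $\mathcal{A}$ is a finite nonempty set of letters, and $\diamond\notin\mathcal{A}$ is a wildcard symbol. A partial word over $\mathcal{A}$ is a finite sequence over $\mathcal{A}\cup\{\diamond\}$; $|w|$ denotes its length. A partial word $u$ covers a word $v$ at a position if $v$ is obtained from the substring of $u$ of length $|v|$ starting at that position by replacing each $\diamond$ by some letter of $\mathcal{A}$ (different occurrences of $\diamond$ may be replaced independently). A universal partial word (upword) for $\mathcal{A}^n$ is a partial word over $\mathcal{A}$ that covers every word in $\mathcal{A}^n$ exactly once, i.e. at exactly one position (upwords with no $\diamond$ are allowed). A partial matrix over $\mathcal{A}$ is a rectangular matrix with entries in $\mathcal{A}\cup\{\diamond\}$. A $w\times\ell$ subarray is a block of $w$ consecutive rows and $\ell$ consecutive columns. $\mathcal{A}^{w\times\ell}$ is the set of matrices over $\mathcal{A}$ with $w$ rows and $\ell$ columns. A partial matrix covers a matrix $t\in\mathcal{A}^{w\times \ell}$ at a position if $t$ is obtained from the $w\times\ell$ subarray whose top-left corner is at that position by replacing each $\diamond$ by some letter of $\mathcal{A}$. A universal partial matrix (upmatrix) for $\mathcal{A}^{w\times\ell}$ is a partial matrix over $\mathcal{A}$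 in which every matrix in $\mathcal{A}^{w\times\ell}$ is covered exactly once (at exactly one position). *)

(* Defs.v *)
From mathcomp Require Import all_boot all_algebra.

Set Implicit Arguments.
Unset Strict Implicit.
Unset Printing Implicit Defensive.

(* The extended alphabet is [option A]: [Some a] is the letter [a] and [None]
   is the wildcard.  Positions are 0-based. *)

Definition pword (A : Type) := seq (option A).

Definition pmatrix (A : Type) (r c : nat) := 'M[option A]_(r, c).

Definition fills (A : eqType) (x : option A) (a : A) : bool :=
  if x is Some b then b == a else true.

Definition word_covers (A : eqType) (u : pword A) (i : nat) (v : seq A) : bool :=
  (i + size v <= size u) && all2 (@fills A) (take (size v) (drop i u)) v.

Definition upword (A : eqType) (n : nat) (u : pword A) : Prop :=
  forall v : n.-tuple A, exists! i : nat, word_covers u i v.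

(* The [w] x [l] block of [M] with top-left corner [(i, j)]: row [a] of the
   block is row [i + a] of [M], and column [b] is column [j + b]. *)
Definition subarray (T : Type) (r c w l i j : nat)
    (hi : i + w <= r) (hj : j + l <= c) (M : 'M[T]_(r, c)) : 'M[T]_(w, l) :=
  mxsub (fun a : 'I_w => widen_ord hi (rshift i a))
        (fun b : 'I_l => widen_ord hj (rshift j b)) M.

Definition mx_covers (A : eqType) (r c w l : nat)
    (M : pmatrix A r c) (pos : nat * nat) (t : 'M[A]_(w, l)) : Prop :=
  exists (hi : pos.1 + w <= r) (hj : pos.2 + l <= c),
    forall (a : 'I_w) (b : 'I_l), fills (subarray hi hj M a b) (t a b).

Definition upmatrix (A : eqType) (w l r c : nat) (M : pmatrix A r c) : Prop :=
  forall t : 'M[A]_(w, l), exists! pos : nat * nat, mx_covers M pos t.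

Definition mu (A : Type) (w : pword A) (p : nat) : pmatrix A p (size w) :=
  (\matrix_(i < p, j < size w)
     if nat_of_ord i == 0%N then tnth (in_tuple w) j else None)%R.

(* Main.v *)
Require Import Defs.
From mathcomp Require Import all_boot all_algebra.

(** A block with [p] rows inside a matrix with [p] rows can only start at row
    0, so the positions available in [mu w p] are just the columns.  Below its
    first row the matrix consists of wildcards, which accept every letter;
    hence the block at column [j] fills to [t] exactly when [w] covers the
    first row of [t] at [j] ([mx_covers_mu]).  As the first row of [t] is a
    word of length [n], it is covered at a unique column, and so is [t]. *)

(** The letter [a0] only serves as a default value for reading [v]. *)
Lemma word_coversP (A : eqType) (a0 : A) (n : nat) (u : pword A) (i : nat)
    (v : n.-tuple A) :
  word_covers u i v <->
  i + n <= size u /\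
  forall b : 'I_n, fills (nth None u (i + b)) (tnth v b).
Proof.
rewrite /word_covers size_tuple; split.
- case/andP=> hi; rewrite all2E => /andP [/eqP hsz /(all_nthP (None, a0)) hall].
  split=> // b; move: (hall b).
  rewrite size_zip hsz size_tuple minnn nth_zip //= nth_take // nth_drop.
  by rewrite (tnth_nth a0); apply.
- case=> hi hb; have hsz : size (take n (drop i u)) = size v.
    by rewrite size_tuple size_takel // size_drop leq_subRL // (leq_trans _ hi) ?leq_addr.
  rewrite hi all2E hsz eqxx /=; apply/(all_nthP (None, a0)) => k.
  rewrite size_zip hsz size_tuple minnn => hk.
  rewrite nth_zip //= nth_take // nth_drop.
  by move: (hb (Ordinal hk)); rewrite (tnth_nth a0).
Qed.

Lemma mx_covers_mu (A : eqType) (n p : nat) (w : pword A) (pos : nat * nat)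
    (t : 'M[A]_(p.+1, n.+1)) :
  mx_covers (mu w p.+1) pos t <->
  pos.1 = 0 /\ word_covers w pos.2 [tuple t ord0 b | b < n.+1].
Proof.
case: pos => i j /=.
have coversP := word_coversP _ (t ord0 ord0) _ w j [tuple t ord0 b | b < n.+1].
split.
- case=> /= hi [hj hfill].
  have i0 : i = 0.
    by apply/eqP; move: (hi); rewrite -leqn0 -{2}[p.+1]add0n leq_add2r.
  split=> //; apply/coversP; split=> // b.
  by move: (hfill ord0 b); rewrite !mxE /= i0 /= (tnth_nth None) tnth_mktuple.
- case=> -> /coversP [hj hfill].
  exists (leqnn _ : (0, j).1 + p.+1 <= p.+1), hj => a b.
  rewrite !mxE /= add0n; case: eqP => // a0.
  have -> : a = ord0 by apply: val_inj.
  by move: (hfill b); rewrite (tnth_nth None) tnth_mktuple.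
Qed.

Theorem theorem4p1 (A : finType) (hA : 0 < #|A|) (n p : nat)
    (hn : 1 <= n) (hp : 2 <= p) (w : pword A) (hw : upword n w) :
  upmatrix p n (mu w p).
Proof.
case: n hn hw => // n _ hw; case: p hp => // p _ t.
have [j [hj uniq_j]] := hw [tuple t ord0 b | b < n.+1].
exists (0, j); split; first exact/mx_covers_mu.
by case=> i k /mx_covers_mu [/= -> /uniq_j ->].
Qed.
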